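(* Let $\mathcal S\subset\mathbb R^n$ be nonempty, closed and convex, let $F:\mathbb R^n\to\mathbb R^n$ be continuous, and let $\mathbb M:\mathbb R^n\to\mathbb R^{n\times n}$ take symmetric positive definite values. Suppose there are constants $L\ge1$, $K>0$, $K_M\ge0$, $\mu>0$ such that for all $x,y\in\mathcal S$: $\|\mathbb M(x)\|\le L$, $\|\mathbb M(x)^{-1}\|\le L$, $\|F(x)-F(y)\|\le K\|x-y\|$, $\|\mathbb M(x)-\mathbb M(y)\|\le K_M\|x-y\|$, and $\langle F(x)-F(y),x-y\rangle\ge\mu\|x-y\|^2$. Let $\lambda>0$, $$0<\alpha<\frac{2\mu}{LK^2},\qquad \rho:=\sqrt{1-\frac{2\alpha\mu}{L}+\alpha^2K^2},$$ let $\bar x\in\operatorname{SOL}(F,\mathcal S)$, and put $r(x):=\|x-\bar x\|_{\mathbb M(x)^{-1}}$. Suppose $\mathcal S$ is compact and put $F_{\max}:=\sup_{x\in\mathcal S}\|F(x)\|$. If $$c_g:=1-\rho-\frac{\alpha}{2}L^2K_MF_{\max}>0,$$ then every trajectory of $\dot x=\lambda(T(x)-x)$ satisfies $$r(x(t))\le e^{-\lambda c_gt}\,r(x(0)),\qquad \|x(t)-\bar x\|\le L\,e^{-\lambda c_gt}\,\|x(0)-\bar x\|.$$ Moreover, the condition $c_g>0$ holds for some $\alpha>0$ if and only if $\mu/L>\tfrac12L^2K_MF_{\max}$.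
   Context: $\langle\cdot,\cdot\rangle$ and $\|\cdot\|$ are the Euclidean inner product and norm (operator norm for matrices); for $Q$ symmetric positive definite, $\|x\|_Q:=\sqrt{x^\top Qx}$ and $P_{\mathcal S,Q}(y):=\operatorname{argmin}_{z\in\mathcal S}\tfrac12\|z-y\|_Q^2$ (exists and is unique). $\operatorname{SOL}(F,\mathcal S)$ is the set of $\bar x\in\mathcal S$ with $\langle F(\bar x),x-\bar x\rangle\ge0$ for all $x\in\mathcal S$. The map $T:\mathcal S\to\mathcal S$ is $T(x):=P_{\mathcal S,\mathbb M(x)^{-1}}\bigl(x-\alpha\mathbb M(x)F(x)\bigr)$. Trajectories are locally absolutely continuous $\mathcal S$-valued solutions of $\dot x=\lambda(T(x)-x)$ with $x(0)\in\mathcal S$. In the last assertion $\rho$ and $c_g$ are regarded as functions of $\alpha$, the other constants being fixed.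
   Formalization: In the last assertion, when S is a single point it is additionally assumed that the expression under the root in ρ is nonnegative for all 0<α<2μ/(LK²), since otherwise ρ is not real on that range and the equivalence can fail. *)

(* Defs.v *)
From HB Require Import structures.
From mathcomp Require Export all_boot all_order all_algebra.
From mathcomp Require Export all_classical all_reals all_analysis.
Export Order.TTheory GRing.Theory Num.Theory.
Export numFieldNormedType.Exports.

Set Implicit Arguments.
Unset Strict Implicit.
Unset Printing Implicit Defensive.

Local Open Scope classical_set_scope.
Local Open Scope ring_scope.

(* The norm that the library puts on 'cV[R]_n is the sup norm.  It provides the
   topology (closed, compact, continuous, derivatives); every quantitative
   estimate uses the Euclidean and Q-weighted norms below. *)
Definition dotp (R : realType) (n : nat) (x y : 'cV[R]_n) : R :=
  \sum_(i < n) x i 0 * y i 0.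

Definition enorm (R : realType) (n : nat) (x : 'cV[R]_n) : R :=
  Num.sqrt (dotp x x).

Definition opnorm (R : realType) (n : nat) (A : 'M[R]_n) : R :=
  sup [set enorm (A *m x) | x in [set x : 'cV[R]_n | enorm x <= 1]].

Definition sym_posdef (R : realType) (n : nat) (Q : 'M[R]_n) : Prop :=
  Q^T = Q /\ forall x : 'cV[R]_n, x != 0 -> 0 < (x^T *m Q *m x) 0 0.

Definition qnorm (R : realType) (n : nat) (Q : 'M[R]_n) (x : 'cV[R]_n) : R :=
  Num.sqrt ((x^T *m Q *m x) 0 0).

Definition argmin_set (R : realType) (U : Type) (S : set U) (f : U -> R) :
    set U :=
  [set z | S z /\ forall w, S w -> f z <= f w].

(* The default value 0 is only returned when there is no minimizer; for S
   nonempty, closed and convex and Q symmetric positive definite, the minimizer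
   exists and is unique. *)
Definition proj (R : realType) (n : nat) (S : set 'cV[R]_n) (Q : 'M[R]_n)
    (y : 'cV[R]_n) : 'cV[R]_n :=
  xget 0 (argmin_set S (fun z => 2^-1 * qnorm Q (z - y) ^+ 2)).

Definition SOL (R : realType) (n : nat) (F : 'cV[R]_n -> 'cV[R]_n)
    (S : set 'cV[R]_n) : set 'cV[R]_n :=
  [set z | S z /\ forall x, S x -> 0 <= dotp (F z) (x - z)].

Definition Tmap (R : realType) (n : nat) (S : set 'cV[R]_n)
    (F : 'cV[R]_n -> 'cV[R]_n) (M : 'cV[R]_n -> 'M[R]_n) (alpha : R)
    (x : 'cV[R]_n) : 'cV[R]_n :=
  proj S (invmx (M x)) (x - alpha *: (M x *m F x)).

Definition abs_continuous_on (R : realType) (n : nat) (a b : R)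
    (x : R -> 'cV[R]_n) : Prop :=
  forall eps : R, 0 < eps -> exists2 delta : R, 0 < delta &
    forall (m : nat) (u v : 'I_m -> R),
      (forall i, a <= u i /\ u i <= v i /\ v i <= b) ->
      (forall i j, i != j -> v i <= u j \/ v j <= u i) ->
      \sum_(i < m) (v i - u i) < delta ->
      \sum_(i < m) enorm (x (v i) - x (u i)) < eps.

(* A trajectory on [0, +oo[; the values x t for t < 0 are irrelevant. *)
Definition trajectory (R : realType) (n : nat) (S : set 'cV[R]_n)
    (lambda : R) (T : 'cV[R]_n -> 'cV[R]_n) (x : R -> 'cV[R]_n) : Prop :=
  [/\ forall t, 0 <= t -> S (x t),
      forall b, 0 <= b -> abs_continuous_on 0 b x
    & {ae @lebesgue_measure R, forall t : R, 0 < t ->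
        is_derive t (1 : R) x (lambda *: (T (x t) - x t))}].

Definition rho_radicand (R : realType) (L K mu alpha : R) : R :=
  1 - 2 * alpha * mu / L + alpha ^+ 2 * K ^+ 2.

(* Num.sqrt is 0 on negative numbers.  Under the Lipschitz and strong
   monotonicity hypotheses on F, the radicand is nonnegative for every alpha as
   soon as S has two distinct points, because then mu / L <= mu <= K. *)
Definition rho (R : realType) (L K mu alpha : R) : R :=
  Num.sqrt (rho_radicand L K mu alpha).

Definition Fmax (R : realType) (n : nat) (F : 'cV[R]_n -> 'cV[R]_n)
    (S : set 'cV[R]_n) : R :=
  sup [set enorm (F x) | x in S].

Definition c_g (R : realType) (L K KM mu fmax alpha : R) : R :=
  1 - rho L K mu alpha - alpha / 2 * L ^+ 2 * KM * fmax.

Definition rdist (R : realType) (n : nat) (M : 'cV[R]_n -> 'M[R]_n)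
    (xbar x : 'cV[R]_n) : R :=
  qnorm (invmx (M x)) (x - xbar).

(* Main.v *)
(* Fix a point z = x(t) where x is differentiable, put d = z - xbar and
   A = M(z)^-1, and let q = r ^+ 2 = <d, A d>.  The variational inequality of
   the projection gives, by Cauchy--Schwarz for the form A, both
   <d, A (T z - xbar)> <= rho * q and |T z - z| <= alpha * L * Fmax.  Since M is
   only Lipschitz, q o x need not be differentiable at t, but
     A(y) - A(z) = A(y) (M(z) - M(y)) A(z)   and   |A d| ^+ 2 <= L * q
   bound the upper derivative of q o x by
     2 * lambda * (rho - 1) * q + lambda * alpha * L ^+ 2 * KM * Fmax * q
       = - 2 * lambda * c_g * q.
   Hence exp(2 * lambda * c_g * t) * q(x(t)), which is absolutely continuous,
   has upper derivative <= 0 almost everywhere and does not exceed its initial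
   value.  For the last assertion, rho is bounded below by its tangent
   line 1 - alpha * mu / L at alpha = 0 because mu / L <= K. *)

Require Import Defs.
From mathcomp Require Import ring lra measurable_realfun.

Set Implicit Arguments.
Unset Strict Implicit.
Unset Printing Implicit Defensive.

Local Open Scope classical_set_scope.
Local Open Scope ring_scope.

(** * Weighted inner products and the operator norm *)

Section Forms.
Variables (R : realType) (n : nat).
Implicit Types (x y z : 'cV[R]_n) (A B : 'M[R]_n) (a L : R).

Lemma dotpE x y : dotp x y = (x^T *m y) 0 0.
Proof. by rewrite mxE; apply: eq_bigr => i _; rewrite mxE. Qed.

Lemma dotpC x y : dotp x y = dotp y x.
Proof. by apply: eq_bigr => i _; rewrite mulrC. Qed.

Lemma dotpDl x y z : dotp (x + y) z = dotp x z + dotp y z.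
Proof. by rewrite !dotpE linearD mulmxDl mxE. Qed.

Lemma dotpDr x y z : dotp x (y + z) = dotp x y + dotp x z.
Proof. by rewrite !dotpE mulmxDr mxE. Qed.

Lemma dotpNl x y : dotp (- x) y = - dotp x y.
Proof. by rewrite !dotpE linearN mulNmx mxE. Qed.

Lemma dotpNr x y : dotp x (- y) = - dotp x y.
Proof. by rewrite !dotpE mulmxN mxE. Qed.

Lemma dotpZl a x y : dotp (a *: x) y = a * dotp x y.
Proof. by rewrite !dotpE linearZ -scalemxAl mxE. Qed.

Lemma dotpZr a x y : dotp x (a *: y) = a * dotp x y.
Proof. by rewrite !dotpE -scalemxAr mxE. Qed.

Definition dotp_lin := (dotpDl, dotpDr, dotpNl, dotpNr, dotpZl, dotpZr).

Lemma dotp0l x : dotp 0 x = 0.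
Proof. by rewrite dotpE trmx0 mul0mx mxE. Qed.

Lemma dotp_mull A x y : dotp (A *m x) y = dotp x (A^T *m y).
Proof. by rewrite !dotpE trmx_mul mulmxA. Qed.

Lemma dotp_ge0 x : 0 <= dotp x x.
Proof. by apply: sumr_ge0 => i _; rewrite -expr2 sqr_ge0. Qed.

Lemma dotp_eq0 x : dotp x x = 0 -> x = 0.
Proof.
move=> /eqP; rewrite psumr_eq0 => [|i _]; last by rewrite -expr2 sqr_ge0.
move=> /allP x0; apply/colP => i; apply/eqP; rewrite mxE.
by have := x0 i (mem_index_enum _); rewrite /= mulf_eq0 orbb.
Qed.

(** One notion covers both the Euclidean form, through the identity matrix, and the forms given by
    [invmx (M x)]. *)
Definition sym_semidef A := A^T = A /\ forall x, 0 <= dotp x (A *m x).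

Lemma sym_semidef1 : sym_semidef 1%:M.
Proof. by split=> [|x]; rewrite ?trmx1 // mul1mx dotp_ge0. Qed.

Lemma form_sym A x y : sym_semidef A -> dotp x (A *m y) = dotp y (A *m x).
Proof. by move=> [At _]; rewrite dotpC dotp_mull At. Qed.

Lemma form_addE A x y : sym_semidef A ->
  dotp (x + y) (A *m (x + y)) =
  dotp x (A *m x) + 2 * dotp x (A *m y) + dotp y (A *m y).
Proof.
by move=> sA; rewrite !(mulmxDr, dotp_lin) (form_sym y x sA); ring.
Qed.

Lemma form_cauchy_schwarz A x y : sym_semidef A ->
  dotp x (A *m y) ^+ 2 <= dotp x (A *m x) * dotp y (A *m y).
Proof.
move=> sA; have [_ A0] := sA.
have E a b : dotp (a *: x + b *: y) (A *m (a *: x + b *: y)) =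
  a ^+ 2 * dotp x (A *m x) + 2 * a * b * dotp x (A *m y)
   + b ^+ 2 * dotp y (A *m y).
  by rewrite form_addE // -!scalemxAr !dotp_lin; ring.
set p := dotp x (A *m y) in E *; set q := dotp x (A *m x) in E *.
set r := dotp y (A *m y) in E *.
have r0 : 0 <= r by exact: A0.
have [r_eq0|r_neq0] := eqVneq r 0.
  rewrite r_eq0 mulr0; have [->|p0] := eqVneq p 0; first by rewrite expr0n.
  (* With [r = 0] the form is affine along [x + s *: y]; this choice of [s] would give it the value
     -1. *)
  have := A0 (1 *: x + (- (q + 1) / (2 * p)) *: y); rewrite E r_eq0.
  suff -> : 1 ^+ 2 * q + 2 * 1 * (- (q + 1) / (2 * p)) * p
    + (- (q + 1) / (2 * p)) ^+ 2 * 0 = - 1 by lra.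
  by field.
have := A0 (r *: x + (- p) *: y); rewrite E.
have -> : r ^+ 2 * q + 2 * r * (- p) * p + (- p) ^+ 2 * r = r * (q * r - p ^+ 2).
  by ring.
by rewrite pmulr_rge0 ?subr_ge0 // lt0r r_neq0.
Qed.

Lemma enorm_ge0 x : 0 <= enorm x.
Proof. exact: sqrtr_ge0. Qed.

Lemma sqr_enorm x : enorm x ^+ 2 = dotp x x.
Proof. by rewrite sqr_sqrtr ?dotp_ge0. Qed.

Lemma enorm0 : enorm (0 : 'cV[R]_n) = 0.
Proof. by rewrite /enorm dotp0l sqrtr0. Qed.

Lemma enorm_eq0 x : enorm x = 0 -> x = 0.
Proof. by move=> x0; apply: dotp_eq0; rewrite -sqr_enorm x0 expr0n. Qed.

Lemma enormZ a x : enorm (a *: x) = `|a| * enorm x.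
Proof.
by rewrite /enorm dotpZl dotpZr mulrA -expr2 sqrtrM ?sqr_ge0// sqrtr_sqr.
Qed.

Lemma enormN x : enorm (- x) = enorm x.
Proof. by rewrite /enorm dotpNl dotpNr opprK. Qed.

Lemma enormB x y : enorm (x - y) = enorm (y - x).
Proof. by rewrite -enormN opprB. Qed.

Lemma dotp_le_enorm x y : `|dotp x y| <= enorm x * enorm y.
Proof.
rewrite -(@ler_pXn2r _ 2) ?nnegrE ?mulr_ge0 ?enorm_ge0//.
rewrite exprMn !sqr_enorm -normrX ger0_norm ?sqr_ge0//.
by have := form_cauchy_schwarz x y sym_semidef1; rewrite !mul1mx.
Qed.

Lemma enormD x y : enorm (x + y) <= enorm x + enorm y.
Proof.
rewrite -(@ler_pXn2r _ 2) ?nnegrE ?addr_ge0 ?enorm_ge0//.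
rewrite sqrrD !sqr_enorm !dotp_lin (dotpC y x).
have := le_trans (ler_norm _) (dotp_le_enorm x y).
rewrite mulr2n; lra.
Qed.

(** Cauchy--Schwarz row by row. This Frobenius bound makes the set in [opnorm] bounded, so that its
    [sup] is a true supremum. *)
Lemma enorm_mulmx_frobenius A x :
  enorm (A *m x) <= Num.sqrt (\sum_i enorm (row i A)^T ^+ 2) * enorm x.
Proof.
rewrite -(@ler_pXn2r _ 2) ?nnegrE ?mulr_ge0 ?sqrtr_ge0 ?enorm_ge0//.
rewrite exprMn [X in _ <= X * _]sqr_sqrtr; last first.
  by apply: sumr_ge0 => i _; exact: sqr_ge0.
rewrite sqr_enorm mulr_suml; apply: ler_sum => i _.
have -> : (A *m x) i 0 = dotp (row i A)^T x.
  by rewrite mxE; apply: eq_bigr => j _; rewrite !mxE.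
rewrite -expr2 -exprMn -[leLHS]ger0_norm ?sqr_ge0// normrX.
by rewrite lerXn2r ?nnegrE ?mulr_ge0 ?enorm_ge0 ?dotp_le_enorm.
Qed.

Lemma opnorm_has_ubound A :
  has_ubound [set enorm (A *m x) | x in [set x | enorm x <= 1]].
Proof.
exists (Num.sqrt (\sum_i enorm (row i A)^T ^+ 2)) => _ [z /= z1 <-].
apply: le_trans (enorm_mulmx_frobenius A z) _.
by rewrite ler_piMr ?sqrtr_ge0.
Qed.

Lemma opnorm_ge0 A : 0 <= opnorm A.
Proof.
apply: (ub_le_sup (opnorm_has_ubound A)).
by exists 0; rewrite /= ?mulmx0 enorm0 ?ler01.
Qed.

Lemma enorm_mulmx A x : enorm (A *m x) <= opnorm A * enorm x.
Proof.
have [x0|x0] := eqVneq (enorm x) 0.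
  by rewrite (enorm_eq0 x0) mulmx0 enorm0 mulr0.
have xp : 0 < enorm x by rewrite lt0r x0 enorm_ge0.
rewrite -ler_pdivrMr// mulrC.
have -> : (enorm x)^-1 * enorm (A *m x) = enorm (A *m ((enorm x)^-1 *: x)).
  by rewrite -scalemxAr enormZ ger0_norm // invr_ge0 ltW.
apply: (ub_le_sup (opnorm_has_ubound A)).
exists ((enorm x)^-1 *: x) => //=.
by rewrite enormZ ger0_norm ?invr_ge0 ?mulVf // ltW.
Qed.

Lemma enorm_mulmx_le A L x : opnorm A <= L -> enorm (A *m x) <= L * enorm x.
Proof.
by move=> AL; apply: le_trans (enorm_mulmx A x) _; rewrite ler_wpM2r ?enorm_ge0.
Qed.

(** A nonzero kernel vector would make the quadratic form vanish. *)
Lemma sym_posdef_unit A : sym_posdef A -> A \in unitmx.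
Proof.
move=> [At Ap]; rewrite unitmxE unitfE; apply/negP => /det0P[v v0 vA].
have := Ap v^T; rewrite trmxK vA mul0mx mxE ltxx.
by rewrite -(inj_eq trmx_inj) trmxK trmx0 v0 => /(_ isT).
Qed.

Lemma sym_posdefW A : sym_posdef A -> sym_semidef A.
Proof.
move=> [At Ap]; split=> // x; have [->|x0] := eqVneq x 0.
  by rewrite dotp0l.
by rewrite dotpE mulmxA ltW ?Ap.
Qed.

Lemma sym_semidef_inv A : sym_posdef A -> sym_semidef (invmx A).
Proof.
move=> sA; have [At A0] := sym_posdefW sA.
have uA := sym_posdef_unit sA; split=> [|x]; first by rewrite trmx_inv At.
by rewrite -{1}(mulKVmx uA x) dotpC; exact: A0.
Qed.

Lemma qnormE A x : qnorm A x = Num.sqrt (dotp x (A *m x)).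
Proof. by rewrite /qnorm dotpE mulmxA. Qed.

Lemma sqr_qnorm A x : sym_semidef A -> qnorm A x ^+ 2 = dotp x (A *m x).
Proof. by move=> [_ A0]; rewrite qnormE sqr_sqrtr. Qed.

Lemma form_le A L x : opnorm A <= L -> dotp x (A *m x) <= L * enorm x ^+ 2.
Proof.
move=> AL; apply: le_trans (ler_norm _) _.
apply: le_trans (dotp_le_enorm _ _) _.
rewrite mulrC expr2 mulrA ler_wpM2r ?enorm_ge0//; exact: enorm_mulmx_le.
Qed.

(* Cauchy--Schwarz for the form [A], applied to [x] and [A *m x]. *)
Lemma enorm_mulmx_form A L x : sym_semidef A -> opnorm A <= L ->
  enorm (A *m x) ^+ 2 <= L * dotp x (A *m x).
Proof.
move=> sA AL; have := form_cauchy_schwarz (A *m x) x sA.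
rewrite -sqr_enorm => cs.
(* In [cs] the left side is [enorm (A *m x) ^+ 4] and the first factor on the right is at most
   [L * enorm (A *m x) ^+ 2]; the common square cancels once it is nonzero. *)
have [->|Ax0] := eqVneq (enorm (A *m x)) 0.
  by rewrite expr0n /= mulr_ge0 ?(proj2 sA) ?(le_trans (opnorm_ge0 A)).
have p0 : 0 < enorm (A *m x) ^+ 2 by rewrite exprn_gt0 // lt0r Ax0 enorm_ge0.
rewrite -(ler_pM2l p0) -expr2; apply: le_trans cs _.
rewrite [leRHS]mulrA ler_wpM2r ?(proj2 sA)//.
by rewrite [_ * L]mulrC; exact: form_le.
Qed.

(** This is [enorm_mulmx_form] at the vector [invmx A *m x]. *)
Lemma enorm_le_inv_form A L x : sym_posdef A -> opnorm A <= L ->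
  enorm x ^+ 2 <= L * dotp x (invmx A *m x).
Proof.
move=> sA AL; have uA := sym_posdef_unit sA.
have := enorm_mulmx_form (invmx A *m x) (sym_posdefW sA) AL.
by rewrite mulKVmx // dotpC.
Qed.

(** The resolvent identity, which carries the Lipschitz bound on [M] over to the inverse
    matrices. *)
Lemma invmxB A B : A \in unitmx -> B \in unitmx ->
  invmx B - invmx A = invmx B *m (A - B) *m invmx A.
Proof.
by move=> uA uB; rewrite mulmxBr mulmxBl -mulmxA mulmxV // mulmx1 mulVmx // mul1mx.
Qed.

End Forms.

(** * Absolute continuity and upper derivatives *)

Section AbsoluteContinuity.
Variable R : realType.
Implicit Types (a b : R) (l : seq (R * R)).

(** The list runs from right to left, so that an induction moving to the right adds each new
    interval at the head. *)
Definition nonoverlapping a b l :=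
  all (fun p => [&& a <= p.1, p.1 <= p.2 & p.2 <= b]) l &&
  pairwise (fun p q => q.2 <= p.1) l.

Lemma nonoverlapping_cons a b c p l : nonoverlapping a c l ->
  a <= c -> c <= p.1 -> p.1 <= p.2 -> p.2 <= b -> nonoverlapping a b (p :: l).
Proof.
move=> /andP[/allP lc pl] ac cp pp pb; apply/andP; split => /=; last first.
  by rewrite pl andbT; apply/allP => q /lc /and3P[_ _ /le_trans]; apply.
rewrite (le_trans ac cp) pp pb /=; apply/allP => q /lc /and3P[-> -> qc] /=.
exact: le_trans (le_trans qc cp) (le_trans pp pb).
Qed.

Lemma abs_continuous_on_seq (n : nat) a b (x : R -> 'cV[R]_n) :
  abs_continuous_on a b x -> forall eps : R, 0 < eps ->
  exists2 delta : R, 0 < delta & forall l, nonoverlapping a b l ->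
    \sum_(p <- l) (p.2 - p.1) < delta ->
    \sum_(p <- l) enorm (x p.2 - x p.1) < eps.
Proof.
move=> acx eps /acx[delta d0 acd]; exists delta => // l /andP[/allP lab pl].
rewrite !(big_nth (0, 0)) !big_mkord => sd.
apply: (acd _ (fun i => (nth (0, 0) l i).1) (fun i => (nth (0, 0) l i).2)) => //.
  by move=> i; have /lab /and3P[] := mem_nth (0, 0) (ltn_ord i).
move=> i j; rewrite neq_ltn => /orP[] ij; [right|left];
  by apply: (pairwiseP (0, 0) pl) => //; rewrite inE ltn_ord.
Qed.

(* A continuous induction along [0, b], charging each interval either to the
   derivative bound or, when its tag lies in the exceptional null set, to an
   open cover [U] of small measure. *)
Lemma ae_upper_derivative_le0 (g : R -> R) b : 0 <= b ->
  (forall eps : R, 0 < eps -> exists2 delta : R, 0 < delta &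
    forall l, nonoverlapping 0 b l ->
      \sum_(p <- l) (p.2 - p.1) < delta ->
      \sum_(p <- l) `|g p.2 - g p.1| < eps) ->
  {ae @lebesgue_measure R, forall t : R, 0 < t -> forall eps : R, 0 < eps ->
    \forall s \near t^', 0 <= s -> (g s - g t) / (s - t) <= eps} ->
  g b <= g 0.
Proof.
move=> b0 acg [N [mN N0 badN]].
(* The term [eps * b] pays for the intervals under the derivative bound, the extra [eps] for those
   charged to the exceptional set. *)
suff H eps : 0 < eps -> g b - g 0 <= eps * b + eps.
  rewrite -subr_le0; apply/ler_addgt0Pr => e e0; rewrite add0r.
  have b1 : 0 < b + 1 by rewrite ltr_wpDl.
  have := H _ (divr_gt0 e0 b1).
  suff -> : e / (b + 1) * b + e / (b + 1) = e by [].
  by field; rewrite gt_eqF.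
move=> e0; have [delta d0 acd] := acg _ e0.
pose mu := @lebesgue_measure R.
(* The derivative bound concerns positive times only, so the point 0 joins the exceptional set. *)
have [D [mD D0 ND]] : exists D : set R,
    [/\ measurable D, mu D = 0%E & N `|` [set 0] `<=` D].
  exists (N `|` [set 0 : R]); split => //; first exact: measurableU.
  apply/negligibleP; first exact: measurableU.
  by apply: negligibleU; apply/negligibleP => //; exact: lebesgue_measure_set1.
have [U [oU DU Ud]] : exists U : set R,
    [/\ open U, D `<=` U & (mu U < delta%:E)%E].
  have [|U [oU DU Ud]] := @lebesgue_regularity_outer _ _ delta mD _ d0.
    exact: (eq_ind_r (fun z => (z < +oo)%E) (ltry 0) D0).
  have mU : measurable U by exact: open_measurable.
  exists U; split=> //; apply: le_lt_trans Ud.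
  rewrite -{1}(setDUK DU) /mu.
  apply: le_trans (measureU2 _ _ _) _ => //; first exact: measurableD.
  by rewrite [X in (X + _)%E]D0 add0e.
have NU : N `|` [set 0] `<=` U by exact: subset_trans ND DU.
have mU : measurable U by exact: open_measurable.
(* Each tag [c] gets a radius within which every interval around it is either controlled by the
   derivative or contained in [U]. *)
have gauge c : 0 <= c -> exists2 eta : R, 0 < eta & forall u v,
    0 <= u -> c - eta < u -> u <= c -> c <= v -> v < c + eta ->
    g v - g u <= eps * (v - u) \/ `[u, v[ `<=` U.
  move=> c0; have [cN|cN] := pselect ((N `|` [set 0]) c).
    have /nbhs_ballP[eta /= eta0 cU] : nbhs c U by exact: (oU _ (NU _ cN)).
    exists eta => // u v u0 cu uc cv vc; right => w /=.
    rewrite in_itv/= => /andP[uw wv]; apply: cU.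
    by rewrite /ball/= ltr_distlC; apply/andP; split; lra.
  have cp : 0 < c.
    by rewrite lt0r c0 andbT; apply/eqP => ce; apply: cN; right.
  have : forall eps, 0 < eps ->
      \forall s \near c^', 0 <= s -> (g s - g c) / (s - c) <= eps.
    apply: contrapT => h; apply: cN; left; apply: badN => /= h2.
    by apply: h; exact: h2.
  move=> /(_ _ e0) /nbhs_ballP[eta /= eta0 ceta].
  (* The quotient bound at [c] is applied on [[u, c]] and on [[c, v]] separately; the two estimates
     add up. *)
  have left_ u : 0 <= u -> c - eta < u -> u <= c -> g c - g u <= eps * (c - u).
    move=> u0 cu; rewrite le_eqVlt => /orP[/eqP->|uc]; first by rewrite !subrr mulr0.
    have cu0 : 0 < c - u by rewrite subr_gt0.
    rewrite -ler_pdivrMr // -[leLHS]mulrNN -invrN !opprB.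
    apply: ceta => //; last by rewrite lt_eqF.
    by rewrite /ball/= ltr_distlC; apply/andP; split; lra.
  have right_ v : c <= v -> v < c + eta -> g v - g c <= eps * (v - c).
    rewrite le_eqVlt => /orP[/eqP->|vc] cv; first by rewrite !subrr mulr0.
    rewrite -ler_pdivrMr ?subr_gt0 //.
    apply: ceta => //; last 2 first.
    - by rewrite gt_eqF.
    - exact: le_trans c0 (ltW vc).
    by rewrite /ball/= ltr_distlC; apply/andP; split; lra.
  exists eta => // u v u0 cu uc cv vc; left.
  have := left_ _ u0 cu uc; have := right_ _ cv vc; lra.
pose W (t : R) : set R := U `&` `[0, t[.
have mW t : measurable (W t).
  by apply: measurableI => //; exact: measurable_itv.
(* The invariant at time [t]: [l] holds the intervals charged to [U] so far. Bounding their length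
   by the measure of [W t] lets it grow additively. *)
pose P t l := [/\ nonoverlapping 0 t l,
  ((\sum_(p <- l) (p.2 - p.1))%:E <= mu (W t))%E &
  g t - g 0 <= eps * t + \sum_(p <- l) `|g p.2 - g p.1| ].
have step u v l : 0 <= u -> u <= v -> P u l ->
    g v - g u <= eps * (v - u) \/ `[u, v[ `<=` U -> exists l', P v l'.
  move=> u0 uv [nl sl gl] [guv|uvU].
    exists l; split; last by lra.
      have /andP[/allP la pl] := nl; rewrite /nonoverlapping pl andbT.
      apply/allP => q /la /and3P[-> -> qu] /=; exact: le_trans qu uv.
    apply: le_trans sl _; apply: le_measure; rewrite ?inE; [exact: mW|exact: mW|].
    move=> w; rewrite /W /= !in_itv/= => -[Uw /andP[w0 wu]]; split=> //.
    by rewrite w0 (lt_le_trans wu).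
  exists ((u, v) :: l); split.
  - exact: nonoverlapping_cons nl _ _ _ _.
  - rewrite big_cons /= EFinD addeC.
    (* Half-open intervals make this union disjoint, so the measure grows by exactly [v - u], the
       length of the new interval. *)
    have -> : W v = W u `|` `[u, v[.
      apply/seteqP; rewrite /W; split=> w /=; rewrite !in_itv/=.
        move=> [Uw /andP[w0 wv]]; have [wu|uw] := ltP w u.
          by left; split; rewrite ?w0.
        by right.
      move=> [[Uw /andP[w0 wu]]|/andP[uw wv]].
        by split=> //; rewrite w0 (lt_le_trans wu uv).
      split; first by apply: uvU; rewrite /= in_itv/= uw wv.
      by rewrite wv (le_trans u0 uw).
    rewrite /mu measureU; [|exact: mW|exact: measurable_itv|]; last first.
      rewrite -subset0 /W => w /=; rewrite !in_itv/= => -[[_]].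
        by move=> /andP[_ wu] /andP[/(lt_le_trans wu)]; rewrite ltxx.
    apply: leeD; first exact: sl.
    have muuv := @lebesgue_measure_itv R `[u, v[.
    apply: (eq_ind_r (fun z => (v - u)%:E <= z)%E _ muuv); rewrite /= lte_fin.
    case: ltP => [_|vu]; first by rewrite EFinB.
    by rewrite lee_fin subr_le0.
  - rewrite big_cons /=.
    have := ler_norm (g v - g u).
    have : eps * u <= eps * v by rewrite ler_pM2l.
    lra.
pose A := [set t | 0 <= t <= b /\ exists l, P t l].
have A0 : A 0.
  split; first by rewrite lexx.
  exists [::]; split => //; rewrite ?big_nil //.
  by rewrite subrr mulr0 addr0.
have ubA : ubound A b by move=> t [/andP[]].
have supA : has_sup A by split; [exists 0|exists b].
have s0 : 0 <= sup A by apply: ub_le_sup A0; exists b.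
have sb : sup A <= b by apply: ge_sup => //; exists 0.
have [eta eta0 geta] := gauge _ s0.
have [u [/andP[u0 ub] [l Pu]] su] := sup_adherent eta0 supA.
have us : u <= sup A.
  apply: ub_le_sup; first by exists b.
  by split; [rewrite u0|exists l].
(* The gauge at [sup A] bridges from [u] to [v], so [v] lies in [A]; hence [v] cannot exceed [sup A]
   and the minimum must be [b]. *)
pose v := Num.min b (sup A + eta / 2).
have vb : v <= b by rewrite ge_min lexx.
have sv : sup A <= v by rewrite le_min sb /= lerDl divr_ge0 // ltW.
have [l' Pv] : exists l', P v l'.
  apply: (step u v l) => //; first exact: le_trans us sv.
  apply: geta => //; rewrite gt_min; apply/orP; right; lra.
have : v <= sup A.
  apply: ub_le_sup; first by exists b.
  by split; [rewrite vb (le_trans s0 sv)|exists l'].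
rewrite ge_min => /orP[bs|]; last by lra.
have vE : v = b by apply/eqP; rewrite eq_le vb (le_trans bs sv).
move: Pv; rewrite vE => -[nl sl gl].
apply: le_trans gl _; rewrite lerD2l ltW //; apply: acd => //.
(* The charged intervals have total length at most the measure of [U], below [delta], so absolute
   continuity applies to them. *)
rewrite -lte_fin; apply: le_lt_trans sl (le_lt_trans _ Ud).
apply: le_measure; rewrite ?inE; [exact: mW|exact: mU|exact: subIsetl].
Qed.

End AbsoluteContinuity.

(** * Projections and the residual map *)

Section Continuity.
Variables (R : realType) (n : nat) (T : Type) (E : set_system T).
Context {filterE : Filter E}.
Implicit Types (f g : T -> 'cV[R]_n) (x y : 'cV[R]_n).

Lemma cvg_coord f x i : f t @[t --> E] --> x -> f t i 0 @[t --> E] --> x i 0.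
Proof. by move=> fx; apply: (continuous_cvg _ (@coord_continuous _ _ _ i 0 x)). Qed.

Lemma cvg_dotp f g x y :
  (forall i, f t i 0 @[t --> E] --> x i 0) ->
  (forall i, g t i 0 @[t --> E] --> y i 0) ->
  dotp (f t) (g t) @[t --> E] --> dotp x y.
Proof.
move=> fx gy; apply: cvg_big => [|i _]; first exact: add_continuous.
exact: cvgM.
Qed.

Lemma cvg_enorm f x : (forall i, f t i 0 @[t --> E] --> x i 0) ->
  enorm (f t) @[t --> E] --> enorm x.
Proof.
by move=> fx; apply: (continuous_cvg _ (@sqrt_continuous R (dotp x x)));
  exact: cvg_dotp.
Qed.

Lemma cvg_mulmx_coord (A : 'M[R]_n) f x :
  (forall i, f t i 0 @[t --> E] --> x i 0) ->
  forall i, (A *m f t) i 0 @[t --> E] --> (A *m x) i 0.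
Proof.
move=> fx i.
have Ei y : (A *m y) i 0 = dotp (row i A)^T y.
  by rewrite mxE; apply: eq_bigr => j _; rewrite !mxE.
rewrite Ei; under eq_fun do rewrite Ei.
by apply: cvg_dotp => // j; exact: cvg_cst.
Qed.

End Continuity.

(** * Existence and first-order condition for the weighted projection *)

Section Projection.
Variables (R : realType) (n : nat).
Implicit Types (S : set 'cV[R]_n) (x y z w : 'cV[R]_n) (Q : 'M[R]_n).

Lemma qnorm_continuous Q : continuous (qnorm Q).
Proof.
have -> : qnorm Q = fun x => Num.sqrt (dotp x (Q *m x)).
  by apply/funext => x; rewrite qnormE.
move=> x.
apply: (@continuous_comp _ _ _ (fun x => dotp x (Q *m x)) Num.sqrt);
  last exact: sqrt_continuous.
apply: (@cvg_dotp R n _ (nbhs x) (nbhs_filter x) id) => [i|].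
  exact: coord_continuous.
apply: (@cvg_mulmx_coord R n _ (nbhs x) (nbhs_filter x) Q id) => i.
exact: coord_continuous.
Qed.

(** A continuous function attains its minimum on a compact set, so [proj] does not fall back on its
    default value. *)
Lemma proj_argmin S Q y : S !=set0 -> compact S ->
  argmin_set S (fun z => 2^-1 * qnorm Q (z - y) ^+ 2) (proj S Q y).
Proof.
move=> S0 cS.
have [|c cS1 cmin] := compact_EVT_min
  (f := (fun z => 2^-1 * qnorm Q (z - y) ^+ 2) : 'cV[R]_n -> R) S0 cS.
  apply: continuous_subspaceT => x.
  have qc : {for x, continuous (fun z => qnorm Q (z - y))}.
    apply: (@continuous_comp _ _ _ (fun z => z - y) (qnorm Q)).
      by apply: continuousB; [exact: id|exact: cst_continuous].
    exact: qnorm_continuous.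
  apply: (@continuous_comp _ _ _ (fun z => qnorm Q (z - y))
    (fun r : R => 2^-1 * r ^+ 2)) => //.
  by apply: continuousM; [exact: cst_continuous|exact: exprn_continuous].
apply: (xgetI 0 (x := c)); split; first by rewrite inE in cS1.
by move=> w Sw; apply: cmin; rewrite inE.
Qed.

Lemma convex_segment S z w t : @convex_set R 'cV[R]_n S -> S z -> S w ->
  0 <= t -> t <= 1 -> S (z + t *: (w - z)).
Proof.
move=> cS Sz Sw t0 t1.
have := cS w z (Itv01 t0 t1); rewrite !inE => /(_ Sw Sz).
suff -> : z + t *: (w - z) = conv (Itv01 t0 t1) (w : convex_lmodType _) z by [].
rewrite [RHS]/(t *: w + (1 - t) *: z).
by rewrite scalerBr scalerBl scale1r addrCA.
Qed.

(** First-order optimality: the projection is compared with points of the segment leading from it to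
    [w]. *)
Lemma proj_variational S Q y w : @convex_set R 'cV[R]_n S -> compact S ->
  sym_semidef Q -> S w ->
  0 <= dotp (proj S Q y - y) (Q *m (w - proj S Q y)).
Proof.
move=> cS kS sQ Sw; have S0 : S !=set0 by exists w.
have [Sz zmin] := proj_argmin Q y S0 kS; set z := proj S Q y in Sz zmin *.
set p := dotp _ _; pose c := dotp (w - z) (Q *m (w - z)).
have c0 : 0 <= c by exact: (proj2 sQ).
rewrite leNgt; apply/negP => p0.
(* If [p < 0], this [t] lies in []0, 1]] and satisfies [t * c <= - p], so [2 * p + t * c] is
   negative, against minimality. *)
pose t := - p / (c + 1 - p).
have d0 : 0 < c + 1 - p by lra.
have t0 : 0 < t by rewrite divr_gt0 // oppr_gt0.
have t1 : t <= 1 by rewrite ler_pdivrMr //; lra.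
have tc : t * c <= - p.
  by rewrite /t mulrAC ler_pdivrMr // ler_pM2l ?oppr_gt0 //; lra.
have := zmin _ (convex_segment cS Sz Sw (ltW t0) t1).
rewrite ler_pM2l ?invr_gt0 // !sqr_qnorm //.
have -> : z + t *: (w - z) - y = (z - y) + t *: (w - z) by rewrite addrAC.
rewrite (form_addE (z - y) (t *: (w - z))) // -!scalemxAr dotpZl !dotpZr -/p -/c => h.
have : 0 <= t * (2 * p + t * c) by lra.
by rewrite pmulr_rge0 //; lra.
Qed.

End Projection.

(** * The map [Tmap]: variational inequality, step length and contraction *)

Section ResidualMap.
Variables (R : realType) (n : nat) (S : set 'cV[R]_n).
Variables (F : 'cV[R]_n -> 'cV[R]_n) (M : 'cV[R]_n -> 'M[R]_n).
Variables (L K mu alpha : R).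
Hypothesis S_convex : @convex_set R 'cV[R]_n S.
Hypothesis S_compact : compact S.
Hypothesis alpha_gt0 : 0 < alpha.
Hypothesis M_posdef : forall x, sym_posdef (M x).
Hypothesis M_bounded : forall x, S x -> opnorm (M x) <= L.
Implicit Types x w : 'cV[R]_n.

Local Notation T := (Tmap S F M alpha).

Lemma Tmap_in x : S x -> S (T x).
Proof.
by move=> Sx; have [|] := proj_argmin (S := S) (invmx (M x))
  (x - alpha *: (M x *m F x)) _ S_compact; first by exists x.
Qed.

(** In the projection inequality the weight [invmx (M x)] cancels the preconditioner [M x], leaving
    [F x] itself. *)
Lemma Tmap_variational x w : S x -> S w ->
  0 <= dotp (T x - x) (invmx (M x) *m (w - T x)) + alpha * dotp (F x) (w - T x).
Proof.
move=> Sx Sw; have uM := sym_posdef_unit (M_posdef x).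
have sA := sym_semidef_inv (M_posdef x).
have := proj_variational (x - alpha *: (M x *m F x)) S_convex S_compact sA Sw.
rewrite -/(Tmap S F M alpha x).
have -> : T x - (x - alpha *: (M x *m F x)) = T x - x + alpha *: (M x *m F x).
  by rewrite opprB addrCA addrC.
rewrite dotpDl dotpZl.
suff -> : dotp (M x *m F x) (invmx (M x) *m (w - T x)) = dotp (F x) (w - T x).
  by [].
by rewrite dotp_mull (proj1 (sym_posdefW (M_posdef x))) mulKVmx.
Qed.

(** Testing the variational inequality at [w = x] bounds the form of [T x - x] by
    [alpha * dotp (F x) (x - T x)]; one factor [enorm (T x - x)] then cancels. *)
Lemma Tmap_step x : S x -> enorm (T x - x) <= alpha * L * enorm (F x).
Proof.
move=> Sx; have := Tmap_variational Sx Sx.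
rewrite -[x - T x]opprB mulmxN !dotpNr mulrN => h.
have L0 : 0 <= L by exact: le_trans (opnorm_ge0 _) (M_bounded Sx).
have [->|Tx0] := eqVneq (enorm (T x - x)) 0.
  by rewrite !mulr_ge0 ?enorm_ge0 // ltW.
have Tp : 0 < enorm (T x - x) by rewrite lt0r Tx0 enorm_ge0.
rewrite -(ler_pM2r Tp) -expr2.
apply: le_trans (enorm_le_inv_form _ (M_posdef x) (M_bounded Sx)) _.
rewrite -!mulrA mulrCA ler_wpM2l //.
have : dotp (F x) (x - T x) <= enorm (F x) * enorm (T x - x).
  by rewrite enormB; apply: le_trans (ler_norm _) (dotp_le_enorm _ _).
rewrite -[x - T x]opprB dotpNr => h2.
apply: (@le_trans _ _ (alpha * - dotp (F x) (T x - x))); first by lra.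
by rewrite ler_pM2l.
Qed.

Hypothesis K_gt0 : 0 < K.
Hypothesis L_gt0 : 0 < L.
Hypothesis alpha_lt : alpha < 2 * mu / (L * K ^+ 2).
Hypothesis Minv_bounded : forall x, S x -> opnorm (invmx (M x)) <= L.
Hypothesis F_lipschitz : forall x y, S x -> S y ->
  enorm (F x - F y) <= K * enorm (x - y).
Hypothesis F_strongly_monotone : forall x y, S x -> S y ->
  mu * enorm (x - y) ^+ 2 <= dotp (F x - F y) (x - y).

(** With the metric frozen at [x], the vector [e] is no longer than the explicit step [y], whose
    squared length is at most [rho_radicand] times that of [d]. Cauchy--Schwarz then pairs [d] with
    [e]. *)
Lemma Tmap_contraction xbar x : SOL F S xbar -> S x ->
  dotp (x - xbar) (invmx (M x) *m (T x - xbar)) <=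
  rho L K mu alpha * rdist M xbar x ^+ 2.
Proof.
move=> [Sxb solxb] Sx; have uM := sym_posdef_unit (M_posdef x).
have sM := sym_posdefW (M_posdef x).
have sA := sym_semidef_inv (M_posdef x); set A := invmx (M x) in sA *.
rewrite /rdist sqr_qnorm // -/A.
set d := x - xbar; set e := T x - xbar; pose phi := F x - F xbar.
pose y := d - alpha *: (M x *m phi).
(* The inequality of [T x] tested at [xbar] is added to that of [xbar] tested at [T x]. *)
have eAy : dotp e (A *m e) <= dotp y (A *m e).
  have := Tmap_variational Sx Sxb; have := solxb _ (Tmap_in Sx).
  have -> : xbar - T x = - e by rewrite opprB.
  have -> : T x - x = e - d by rewrite /e /d opprB addrA subrK.
  rewrite -/e -/A => h1; rewrite mulmxN !dotpNr dotpDl dotpNl mulrN => h2.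
  have h3 : 0 <= alpha * dotp (F xbar) e by rewrite mulr_ge0 // ltW.
  rewrite /y dotpDl dotpNl dotpZl.
  have -> : dotp (M x *m phi) (A *m e) = dotp phi e.
    by rewrite dotp_mull (proj1 sM) mulKVmx.
  rewrite /phi dotpDl dotpNl; lra.
have q0 z : 0 <= dotp z (A *m z) by exact: (proj2 sA).
have yq : dotp y (A *m y) <= rho_radicand L K mu alpha * dotp d (A *m d).
  rewrite /y form_addE // mulmxN !dotpNr dotpNl opprK -!scalemxAr !dotpZr dotpZl.
  rewrite mulKmx // -/A.
  have sd : mu * enorm d ^+ 2 <= dotp d phi.
    by rewrite dotpC; exact: F_strongly_monotone.
  have Fd : dotp (M x *m phi) phi <= L * (K ^+ 2 * enorm d ^+ 2).
    rewrite dotpC; apply: le_trans (form_le _ (M_bounded Sx)) _.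
    apply: ler_wpM2l; first exact: ltW.
    rewrite -exprMn lerXn2r ?nnegrE ?enorm_ge0 //.
      by rewrite mulr_ge0 ?enorm_ge0 // ltW.
    exact: F_lipschitz.
  have dq : dotp d (A *m d) <= L * enorm d ^+ 2.
    by apply: form_le; exact: Minv_bounded.
  (* The upper bound on [alpha] makes this coefficient positive, so [enorm d ^+ 2] may be replaced
     by its lower bound [dotp d (A *m d) / L]. *)
  have pos : 0 < 2 * mu - alpha * (L * K ^+ 2).
    by rewrite subr_gt0 -ltr_pdivlMr // mulr_gt0 // exprn_gt0.
  have : (2 * mu - alpha * (L * K ^+ 2)) * (dotp d (A *m d) / L)
      <= (2 * mu - alpha * (L * K ^+ 2)) * enorm d ^+ 2.
    by rewrite ler_pM2l // ler_pdivrMr // mulrC.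
  have : alpha ^+ 2 * dotp (M x *m phi) phi
      <= alpha ^+ 2 * (L * (K ^+ 2 * enorm d ^+ 2)).
    by rewrite ler_pM2l // exprn_gt0.
  have : alpha * (mu * enorm d ^+ 2) <= alpha * dotp d phi by rewrite ler_pM2l.
  move=> h1 h2 h3.
  have : alpha * ((2 * mu - alpha * (L * K ^+ 2)) * (dotp d (A *m d) / L))
      <= alpha * ((2 * mu - alpha * (L * K ^+ 2)) * enorm d ^+ 2).
    by rewrite ler_pM2l.
  have -> : alpha * ((2 * mu - alpha * (L * K ^+ 2)) * (dotp d (A *m d) / L)) =
     (2 * alpha * mu / L - alpha ^+ 2 * K ^+ 2) * dotp d (A *m d).
    by field; rewrite gt_eqF.
  rewrite /rho_radicand; lra.
have [d0|d0] := eqVneq (dotp d (A *m d)) 0.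
  have := form_cauchy_schwarz d e sA; rewrite d0 mul0r => cs.
  suff -> : dotp d (A *m e) = 0 by rewrite mulr0.
  by apply/eqP; rewrite -sqrf_eq0 eq_le cs sqr_ge0.
have dp : 0 < dotp d (A *m d) by rewrite lt0r d0 q0.
(* Nonnegativity of the form at [y] forces the radicand to be nonnegative, so [rho ^+ 2] really is
   the radicand. *)
have rad0 : 0 <= rho_radicand L K mu alpha.
  by rewrite -(pmulr_lge0 _ dp); exact: le_trans (q0 y) yq.
have ele : dotp e (A *m e) <= rho_radicand L K mu alpha * dotp d (A *m d).
  apply: le_trans yq; have [->//|e0] := eqVneq (dotp e (A *m e)) 0.
  have ep : 0 < dotp e (A *m e) by rewrite lt0r e0 q0.
  rewrite -(ler_pM2r ep); apply: le_trans (form_cauchy_schwarz y e sA).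
  by rewrite -expr2 lerXn2r ?nnegrE ?q0 // (le_trans (q0 e)).
apply: le_trans (ler_norm _) _.
rewrite -(@ler_pXn2r _ 2) ?nnegrE ?mulr_ge0 ?sqrtr_ge0 //.
rewrite -normrX ger0_norm ?sqr_ge0 // exprMn sqr_sqrtr //.
apply: le_trans (form_cauchy_schwarz d e sA) _.
by rewrite [X in _ <= _ * X]expr2 mulrA mulrC ler_pM2r.
Qed.

End ResidualMap.

(** * Variation of the metric *)

Section Calculus.
Variable R : realType.

Lemma is_derive_cvg (V : normedModType R) (f : R -> V) (t : R) (w : V) :
  is_derive t 1 f w -> h^-1 *: (f (h + t) - f t) @[h --> 0^'] --> w.
Proof.
move=> [df <-]; rewrite [X in _ --> X]/derive.
have E : (fun h : R => h^-1 *: (f (h + t) - f t)) =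
    (fun h : R => h^-1 *: ((f \o shift t) (h *: 1) - f t)).
  by apply/funext => h /=; rewrite [h *: 1]mulr1.
by rewrite E.
Qed.

Lemma dnbhs_shift (t : R) (P : R -> Prop) :
  (\forall h \near 0^', P (h + t)) -> \forall s \near t^', P s.
Proof.
move=> /nbhs_ballP[e /= e0 eP]; apply/nbhs_ballP; exists e => // s ts st.
rewrite -(subrK t s); apply: eP; last by rewrite subr_eq0.
by move: ts; rewrite /ball/= sub0r normrN distrC.
Qed.

(** Factor out [expR (k * v)] and use [1 - expR (- s) <= s]. *)
Lemma expR_lipschitz (k b u v : R) : 0 <= k -> u <= v -> v <= b ->
  expR (k * v) - expR (k * u) <= expR (k * b) * k * (v - u).
Proof.
move=> k0 uv vb.
have -> : k * u = k * v + - (k * (v - u)) by ring.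
rewrite expRD -[X in X - _]mulr1 -mulrBr -mulrA.
apply: ler_pM => //; rewrite ?expR_ge0 ?ler_expR ?ler_wpM2l //.
  by rewrite subr_ge0 -[leRHS]expR0 ler_expR oppr_le0 mulr_ge0 // subr_ge0.
have := expR_ge1Dx (- (k * (v - u))); lra.
Qed.

(** Half of [eps] goes to the variation of [x], half to the total length of the intervals. *)
Lemma abs_continuous_on_dominated (n : nat) (a b C1 C2 : R)
    (x : R -> 'cV[R]_n) (g : R -> R) :
  abs_continuous_on a b x -> 0 < C1 -> 0 < C2 ->
  (forall u v, a <= u -> u <= v -> v <= b ->
     `|g v - g u| <= C1 * enorm (x v - x u) + C2 * (v - u)) ->
  forall eps : R, 0 < eps -> exists2 delta : R, 0 < delta &
    forall l, nonoverlapping a b l ->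
      \sum_(p <- l) (p.2 - p.1) < delta ->
      \sum_(p <- l) `|g p.2 - g p.1| < eps.
Proof.
move=> acx C10 C20 gC eps e0.
have [|d d0 acd] := abs_continuous_on_seq acx (eps := eps / 2 / C1).
  by rewrite !divr_gt0.
exists (Num.min d (eps / 2 / C2)); first by rewrite lt_min d0 !divr_gt0.
move=> l nl; rewrite lt_min => /andP[ld le].
have := acd _ nl ld; rewrite ltr_pdivlMr // => h1.
move: le; rewrite ltr_pdivlMr // => h2.
apply: (@le_lt_trans _ _ (C1 * \sum_(p <- l) enorm (x p.2 - x p.1) +
   C2 * \sum_(p <- l) (p.2 - p.1))); last by lra.
rewrite !mulr_sumr -big_split /= big_seq [leRHS]big_seq; apply: ler_sum => p pl.
by have /andP[/allP /(_ _ pl) /and3P[? ? ?] _] := nl; exact: gC.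
Qed.

End Calculus.

Section Boundedness.
Variables (R : realType) (n : nat).

Lemma enorm_continuous : continuous (@enorm R n).
Proof.
have -> : @enorm R n = qnorm 1%:M.
  by apply/funext => x; rewrite qnormE mul1mx.
exact: qnorm_continuous.
Qed.

Lemma enorm_has_ubound (S : set 'cV[R]_n) (f : 'cV[R]_n -> 'cV[R]_n) :
  S !=set0 -> compact S -> continuous f ->
  has_ubound [set enorm (f x) | x in S].
Proof.
move=> S0 cS cf; suff [] : has_sup [set enorm (f x) | x in S] by [].
apply: compact_has_sup; first exact: image_nonempty.
apply: continuous_compact => //; apply: continuous_subspaceT => x.
apply: (@continuous_comp _ _ _ f (@enorm R n)); first exact: cf.
exact: enorm_continuous.
Qed.

Lemma le_Fmax (S : set 'cV[R]_n) (F : 'cV[R]_n -> 'cV[R]_n) x :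
  compact S -> continuous F -> S x -> enorm (F x) <= Fmax F S.
Proof.
move=> cS cF Sx; apply: ub_le_sup; last by exists x.
by apply: enorm_has_ubound => //; exists x.
Qed.

End Boundedness.

(** * Change of the squared distance when both the point and the metric move *)

Section Metric.
Variables (R : realType) (n : nat) (S : set 'cV[R]_n).
Variables (M : 'cV[R]_n -> 'M[R]_n) (L KM : R) (xbar : 'cV[R]_n).
Hypothesis M_posdef : forall x, sym_posdef (M x).
Hypothesis L_gt0 : 0 < L.
Hypothesis KM_ge0 : 0 <= KM.
Hypothesis Minv_bounded : forall x, S x -> opnorm (invmx (M x)) <= L.
Hypothesis M_lipschitz : forall x y, S x -> S y ->
  opnorm (M x - M y) <= KM * enorm (x - y).
Implicit Types x y z v w : 'cV[R]_n.

Local Notation A z := (invmx (M z)).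

Let A_semidef z : sym_semidef (A z) := sym_semidef_inv (M_posdef z).

Lemma invmx_diff y z :
  A y - A z = A y *m (M z - M y) *m A z.
Proof. exact: invmxB (sym_posdef_unit _) (sym_posdef_unit _). Qed.

(** Freezes the matrix at [z], with an error that vanishes as [y] tends to [z]. *)
Lemma enorm_invmx_le y z v : S y -> S z ->
  enorm (A y *m v) <= enorm (A z *m v) + L * (KM * enorm (y - z) * (L * enorm v)).
Proof.
move=> Sy Sz; rewrite -{1}(subrK (A z) (A y)) mulmxDl addrC.
apply: le_trans (enormD _ _) _; rewrite lerD2l invmx_diff -!mulmxA.
apply: le_trans (enorm_mulmx_le _ (Minv_bounded Sy)) _; rewrite ler_pM2l //.
rewrite enormB; apply: le_trans (enorm_mulmx_le _ (M_lipschitz Sz Sy)) _.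
rewrite ler_wpM2l ?mulr_ge0 ?enorm_ge0 //.
exact: enorm_mulmx_le (Minv_bounded Sz).
Qed.

(** Moving the symmetric factor [A y] to the left keeps [v] under an inverse matrix on both sides;
    bounding [enorm (A z *m v) ^+ 2] by [L] times the form then costs a single factor [L]. *)
Lemma form_invmx_diff_le y z v : S y -> S z ->
  `|dotp v ((A y - A z) *m v)| <=
  enorm (A y *m v) * (KM * enorm (y - z) * enorm (A z *m v)).
Proof.
move=> Sy Sz; rewrite invmx_diff -!mulmxA -{1}(proj1 (A_semidef y)) -dotp_mull.
apply: le_trans (dotp_le_enorm _ _) _; rewrite ler_wpM2l ?enorm_ge0 //.
by rewrite enormB; exact: enorm_mulmx_le (M_lipschitz Sz Sy).
Qed.

(** The first term is the change of metric; the second is the change of point, a difference of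
    squares in the form at [z]. *)
Lemma sqr_rdistB y z :
  rdist M xbar y ^+ 2 - rdist M xbar z ^+ 2 =
  dotp (y - xbar) ((A y - A z) *m (y - xbar)) +
  dotp (y - z) (A z *m ((y - xbar) + (z - xbar))).
Proof.
rewrite /rdist !sqr_qnorm //; set d := y - xbar; set e := z - xbar.
have -> : y - z = d - e by rewrite /d /e opprB addrA subrK.
clearbody d e; rewrite mulmxBl mulmxDr !dotp_lin (form_sym e d (A_semidef z)); ring.
Qed.

(** All matrices on the right are taken at [z], so the bound has a limit along the trajectory even
    where the left side has none. *)
Lemma rdist_step_le y z D (h : R) : S y -> S z -> h != 0 ->
  D = h^-1 *: (y - z) ->
  (rdist M xbar y ^+ 2 - rdist M xbar z ^+ 2) / h <=
  (enorm (A z *m (y - xbar)) +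
     L * (KM * enorm (y - z) * (L * enorm (y - xbar)))) *
    (KM * enorm D * enorm (A z *m (y - xbar))) +
  dotp D (A z *m ((y - xbar) + (z - xbar))).
Proof.
move=> Sy Sz h0 DE; rewrite sqr_rdistB mulrDl.
have -> : dotp (y - z) (A z *m (y - xbar + (z - xbar))) / h =
    dotp D (A z *m (y - xbar + (z - xbar))) by rewrite DE dotpZl mulrC.
rewrite lerD2r; apply: le_trans (ler_norm _) _.
rewrite normrM normfV.
apply: (@le_trans _ _ (enorm (A y *m (y - xbar)) *
    (KM * enorm D * enorm (A z *m (y - xbar))))).
  rewrite ler_pdivrMr ?normr_gt0 //.
  apply: le_trans (form_invmx_diff_le _ Sy Sz) _.
  rewrite DE enormZ normfV.
  rewrite (_ : _ * _ * `|h| = enorm (A y *m (y - xbar)) *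
    (KM * enorm (y - z) * enorm (A z *m (y - xbar)))) //.
  by field; rewrite normr_eq0.
apply: ler_wpM2r; first by rewrite !mulr_ge0 ?enorm_ge0.
exact: enorm_invmx_le.
Qed.

Lemma sqr_rdist_le x : S x -> rdist M xbar x ^+ 2 <= L * enorm (x - xbar) ^+ 2.
Proof.
by move=> Sx; rewrite /rdist sqr_qnorm //; exact: form_le (Minv_bounded Sx).
Qed.

Lemma sqr_rdist_lipschitz (B : R) y z : S y -> S z ->
  enorm (y - xbar) <= B -> enorm (z - xbar) <= B ->
  `|rdist M xbar y ^+ 2 - rdist M xbar z ^+ 2| <=
  (L * B * (KM * (L * B)) + L * (B + B)) * enorm (y - z).
Proof.
move=> Sy Sz yB zB; rewrite sqr_rdistB mulrDl.
have B0 : 0 <= B by exact: le_trans (enorm_ge0 _) yB.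
have AB w : S w -> enorm (A w *m (y - xbar)) <= L * B.
  move=> Sw; apply: le_trans (enorm_mulmx_le _ (Minv_bounded Sw)) _.
  by rewrite ler_pM2l.
apply: le_trans (ler_normD _ _) _; apply: lerD.
  apply: le_trans (form_invmx_diff_le _ Sy Sz) _.
  rewrite [leRHS](_ : _ = L * B * (KM * enorm (y - z) * (L * B))); last by ring.
  apply: ler_pM; rewrite ?enorm_ge0 ?mulr_ge0 ?enorm_ge0 ?AB //.
  by rewrite ler_wpM2l ?mulr_ge0 ?enorm_ge0 ?AB.
apply: le_trans (dotp_le_enorm _ _) _; rewrite mulrC ler_wpM2r ?enorm_ge0 //.
apply: le_trans (enorm_mulmx_le _ (Minv_bounded Sz)) _; rewrite ler_pM2l //.
by apply: le_trans (enormD _ _) _; exact: lerD.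
Qed.

End Metric.

(** * Decay along trajectories *)

Section Decay.
Variables (R : realType) (n : nat) (S : set 'cV[R]_n).
Variables (M : 'cV[R]_n -> 'M[R]_n) (L KM : R) (xbar : 'cV[R]_n).
Hypothesis M_posdef : forall x, sym_posdef (M x).
Hypothesis L_gt0 : 0 < L.
Hypothesis KM_ge0 : 0 <= KM.
Hypothesis Minv_bounded : forall x, S x -> opnorm (invmx (M x)) <= L.
Hypothesis M_lipschitz : forall x y, S x -> S y ->
  opnorm (M x - M y) <= KM * enorm (x - y).
Variables (x : R -> 'cV[R]_n) (k : R).
Hypothesis x_in : forall t, 0 <= t -> S (x t).

Local Notation A z := (invmx (M z)).
Local Notation g := (fun s => expR (k * s) * rdist M xbar (x s) ^+ 2).

(** A product rule for upper derivatives: the quotient is majorized by a function that converges to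
    a nonpositive limit. *)
Lemma weighted_sqr_rdist_upper_derivative (t : R) (w : 'cV[R]_n) :
  0 <= t -> is_derive t (1 : R) x w ->
  enorm (A (x t) *m (x t - xbar)) *
      (KM * enorm w * enorm (A (x t) *m (x t - xbar))) +
    dotp w (A (x t) *m ((x t - xbar) + (x t - xbar))) <=
  - k * rdist M xbar (x t) ^+ 2 ->
  forall eps : R, 0 < eps ->
    \forall s \near t^', 0 <= s -> (g s - g t) / (s - t) <= eps.
Proof.
move=> t0 dx bound eps eps0; set z := x t in bound *.
pose D h : 'cV[R]_n := h^-1 *: (x (h + t) - z).
(* For [h != 0] this is [x (h + t)]; written through the quotient [D], it visibly tends to [z]. *)
pose y h : 'cV[R]_n := z + h *: D h.
pose H h := (enorm (A z *m (y h - xbar)) +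
     L * (KM * enorm (y h - z) * (L * enorm (y h - xbar)))) *
    (KM * enorm (D h) * enorm (A z *m (y h - xbar))) +
  dotp (D h) (A z *m ((y h - xbar) + (z - xbar))).
pose E h := h^-1 * (expR (k * (h + t)) - expR (k * t)).
pose G h := expR (k * (h + t)) * H h + rdist M xbar z ^+ 2 * E h.
have FF : Filter (0 : R)^' by exact: dnbhs_filter.
have cD i : D h i 0 @[h --> 0^'] --> w i 0.
  by apply: cvg_coord; exact: (is_derive_cvg dx).
have ch : h @[h --> (0 : R)^'] --> (0 : R) by exact: cvg_within.
have cht : h + t @[h --> (0 : R)^'] --> t.
  by rewrite -[X in _ --> X]add0r; apply: cvgD => //; exact: cvg_cst.
have cyv v i : (y h - v) i 0 @[h --> 0^'] --> (z - v) i 0.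
  have -> : (fun h => (y h - v) i 0) = (fun h => z i 0 + h * D h i 0 - v i 0).
    by apply/funext => h; rewrite !mxE.
  rewrite [X in _ --> X](_ : _ = z i 0 + 0 * w i 0 - v i 0); last first.
    by rewrite !mxE mul0r addr0.
  apply: cvgB; last exact: cvg_cst.
  by apply: cvgD; [exact: cvg_cst|exact: cvgM].
have cA : enorm (A z *m (y h - xbar)) @[h --> 0^'] --> enorm (A z *m (z - xbar)).
  by apply: cvg_enorm; exact: cvg_mulmx_coord.
have cH : H h @[h --> 0^'] -->
    (enorm (A z *m (z - xbar)) +
       L * (KM * enorm (z - z) * (L * enorm (z - xbar)))) *
      (KM * enorm w * enorm (A z *m (z - xbar))) +
    dotp w (A z *m ((z - xbar) + (z - xbar))).
  apply: cvgD; last first.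
    apply: cvg_dotp => // ; apply: cvg_mulmx_coord => i.
    under eq_fun do rewrite mxE.
    by rewrite mxE; apply: cvgD => //; exact: cvg_cst.
  apply: cvgM.
    apply: cvgD => //; apply: cvgM; first exact: cvg_cst.
    apply: cvgM; first by apply: cvgM; [exact: cvg_cst|exact: cvg_enorm].
    by apply: cvgM; [exact: cvg_cst|exact: cvg_enorm].
  by apply: cvgM => //; apply: cvgM; [exact: cvg_cst|exact: cvg_enorm].
have ce : expR (k * (h + t)) @[h --> (0 : R)^'] --> expR (k * t).
  apply: (continuous_cvg _ (@continuous_expR R (k * t))).
  by apply: cvgM => //; exact: cvg_cst.
have cE : E h @[h --> 0^'] --> k * expR (k * t).
  have de : is_derive t (1 : R) (fun s => expR (k * s)) (k * expR (k * t)).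
    rewrite mulrC; apply: is_derive1_comp.
    by apply: is_derive_eq; rewrite [LHS]mulr1.
  exact: (is_derive_cvg de).
have cG : G h @[h --> 0^'] --> expR (k * t) *
    ((enorm (A z *m (z - xbar)) +
       L * (KM * enorm (z - z) * (L * enorm (z - xbar)))) *
      (KM * enorm w * enorm (A z *m (z - xbar))) +
    dotp w (A z *m ((z - xbar) + (z - xbar)))) +
    rdist M xbar z ^+ 2 * (k * expR (k * t)).
  by apply: cvgD; apply: cvgM => //; exact: cvg_cst.
(* In the limit the error term carries [enorm (z - z) = 0], and [bound] makes the remainder
   nonpositive. *)
have G0 : expR (k * t) *
    ((enorm (A z *m (z - xbar)) +
       L * (KM * enorm (z - z) * (L * enorm (z - xbar)))) *
      (KM * enorm w * enorm (A z *m (z - xbar))) +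
    dotp w (A z *m ((z - xbar) + (z - xbar)))) +
    rdist M xbar z ^+ 2 * (k * expR (k * t)) <= 0.
  rewrite subrr enorm0 mulr0 mul0r mulr0 addr0.
  have := expR_gt0 (k * t) => e0.
  by move: bound; rewrite -(ler_pM2l e0); lra.
have Gle : \forall h \near (0 : R)^', G h <= eps.
  by apply: (cvgr_le _ cG); exact: le_lt_trans G0 eps0.
apply: dnbhs_shift; near=> h => ht0.
have h0 : h != 0 by near: h; exact: nbhs_dnbhs_neq.
have yE : y h = x (h + t) by rewrite /y /D scalerA divff // scale1r subrKC.
have GE : G h <= eps by near: h.
apply: le_trans GE; rewrite addrK -/z.
have -> : (expR (k * (h + t)) * rdist M xbar (x (h + t)) ^+ 2 -
   expR (k * t) * rdist M xbar z ^+ 2) / h =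
   expR (k * (h + t)) *
     ((rdist M xbar (x (h + t)) ^+ 2 - rdist M xbar z ^+ 2) / h)
   + rdist M xbar z ^+ 2 * E h.
  by rewrite /E; field.
rewrite /G lerD2r ler_pM2l ?expR_gt0 // /H yE.
exact: (rdist_step_le xbar M_posdef L_gt0 KM_ge0 Minv_bounded M_lipschitz
  (x_in ht0) (x_in t0) h0 (erefl (D h))).
Unshelve. all: by end_near.
Qed.

(** On the bounded set [S] the squared distance is Lipschitz, and so is the exponential on [[0, b]];
    hence increments of [g] are dominated by those of [x] and of time. *)
Lemma weighted_sqr_rdist_abs_continuous (b : R) : compact S -> 0 <= k ->
  0 <= b -> abs_continuous_on 0 b x ->
  forall eps : R, 0 < eps -> exists2 delta : R, 0 < delta &
    forall l, nonoverlapping 0 b l ->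
      \sum_(p <- l) (p.2 - p.1) < delta ->
      \sum_(p <- l) `|g p.2 - g p.1| < eps.
Proof.
move=> cS k0 b0 acx.
have [B Bd] : has_ubound [set enorm (y - xbar) | y in S].
  apply: (@enorm_has_ubound R n S (fun y => y - xbar)) => //.
    by exists (x 0); exact: x_in.
  by move=> y; apply: continuousB; [exact: id|exact: cst_continuous].
have {}Bd y : S y -> enorm (y - xbar) <= B by move=> Sy; apply: Bd; exists y.
have B0 : 0 <= B by exact: le_trans (enorm_ge0 _) (Bd _ (x_in (lexx 0))).
pose C := L * B * (KM * (L * B)) + L * (B + B).
have C0 : 0 <= C by rewrite addr_ge0 ?mulr_ge0 ?addr_ge0 // ltW.
have eb0 := expR_gt0 (k * b).
(* The added 1s keep both constants positive, even when [B] or [k] is 0. *)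
apply: (@abs_continuous_on_dominated R n 0 b (expR (k * b) * (C + 1))
  (expR (k * b) * (k + 1) * (L * B ^+ 2 + 1)) x g acx).
- by rewrite mulr_gt0 // ltr_wpDl.
- rewrite !mulr_gt0 // ltr_wpDl // mulr_ge0 ?sqr_ge0 //; exact: ltW.
move=> u v u0 uv vb.
have v0 := le_trans u0 uv; have Su := x_in u0; have Sv := x_in v0.
rewrite (_ : _ - _ =
  expR (k * v) * (rdist M xbar (x v) ^+ 2 - rdist M xbar (x u) ^+ 2) +
  (expR (k * v) - expR (k * u)) * rdist M xbar (x u) ^+ 2); last by ring.
have evu : 0 <= expR (k * v) - expR (k * u).
  by rewrite subr_ge0 ler_expR ler_wpM2l.
apply: le_trans (ler_normD _ _) _; apply: lerD.
  rewrite normrM ger0_norm ?expR_ge0 // -mulrA.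
  apply: ler_pM; rewrite ?expR_ge0 ?ler_expR ?ler_wpM2l //.
  apply: le_trans (sqr_rdist_lipschitz M_posdef L_gt0 KM_ge0 Minv_bounded
    M_lipschitz Sv Su (Bd _ Sv) (Bd _ Su)) _.
  by rewrite ler_wpM2r ?enorm_ge0 // lerDl.
rewrite ger0_norm; last by apply: mulr_ge0 => //; exact: sqr_ge0.
have qu : rdist M xbar (x u) ^+ 2 <= L * B ^+ 2 + 1.
  apply: le_trans (sqr_rdist_le xbar M_posdef Minv_bounded Su) _.
  apply: ler_wpDr => //; rewrite ler_pM2l // lerXn2r ?nnegrE ?enorm_ge0 //.
  exact: Bd.
have ee : expR (k * v) - expR (k * u) <= expR (k * b) * (k + 1) * (v - u).
  apply: le_trans (expR_lipschitz k0 uv vb) _.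
  by rewrite ler_wpM2r ?subr_ge0 // ler_pM2l // lerDl.
rewrite [leRHS]mulrAC; apply: ler_pM => //; exact: sqr_ge0.
Qed.

End Decay.

(** * Step sizes with a positive rate *)

Section Rate.
Variables (R : realType).
Implicit Types L K KM mu fmax alpha : R.

Lemma c_g_gt0_exists L K KM mu fmax : 0 < L -> 0 < K -> 0 < mu ->
  0 <= KM -> 0 <= fmax -> mu / L <= K ->
  (exists alpha, 0 < alpha /\ 0 < c_g L K KM mu fmax alpha) <->
  2^-1 * L ^+ 2 * KM * fmax < mu / L.
Proof.
move=> L0 K0 mu0 KM0 f0 muK; set m := mu / L in muK *.
set kap := 2^-1 * L ^+ 2 * KM * fmax.
have kap0 : 0 <= kap by rewrite !mulr_ge0 ?invr_ge0 // ltW.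
have m0 : 0 < m by rewrite divr_gt0.
have cE alpha : c_g L K KM mu fmax alpha =
    1 - Num.sqrt (1 - 2 * alpha * m + alpha ^+ 2 * K ^+ 2) - alpha * kap.
  rewrite /c_g /rho; congr (_ - Num.sqrt _ - _).
    by rewrite /rho_radicand -[2 * alpha * mu / L]mulrA.
  by rewrite /kap !mulrA.
clearbody m kap.
have mK2 : m ^+ 2 <= K ^+ 2 by rewrite lerXn2r ?nnegrE // ltW.
split=> [[alpha [a0]]|kapm].
  rewrite cE; apply: contraTT; rewrite -!leNgt => mk.
  (* the tangent line of [rho] at 0 lies below [rho] *)
  have : 1 - alpha * m <= Num.sqrt (1 - 2 * alpha * m + alpha ^+ 2 * K ^+ 2).
    apply: le_trans (ler_norm _) _; rewrite -sqrtr_sqr; apply: ler_wsqrtr.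
    have : alpha ^+ 2 * m ^+ 2 <= alpha ^+ 2 * K ^+ 2.
      by rewrite ler_wpM2l ?sqr_ge0.
    have -> : (1 - alpha * m) ^+ 2 =
      1 - 2 * alpha * m + alpha ^+ 2 * m ^+ 2 by ring.
    by rewrite lerD2l.
  have : alpha * m <= alpha * kap by rewrite ler_pM2l.
  lra.
have K20 : 0 < K ^+ 2 by rewrite exprn_gt0.
(* Then [alpha ^+ 2 * K ^+ 2 = alpha * (m - kap)], and [(1 - alpha * kap) ^+ 2] exceeds the radicand
   by [alpha * (m - kap) + (alpha * kap) ^+ 2]. *)
exists ((m - kap) / K ^+ 2); set alpha := _ / _.
have a0 : 0 < alpha by rewrite divr_gt0 // subr_gt0.
have aK : alpha * K ^+ 2 = m - kap by rewrite divfK // gt_eqF.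
split=> //; rewrite cE -addrA -opprD subr_gt0 -ltrBrDr.
(* Holds because [(m - kap) * kap < m ^+ 2 <= K ^+ 2]; it permits comparing squares. *)
have ak1 : alpha * kap < 1.
  rewrite /alpha mulrAC ltr_pdivrMr // mul1r; apply: lt_le_trans mK2.
  have : 0 < (m - kap) ^+ 2 by rewrite exprn_gt0 // subr_gt0.
  have : 0 <= m * kap by rewrite mulr_ge0 // ltW.
  by rewrite sqrrB mulr2n; lra.
have pos : 0 < 1 - alpha * kap by rewrite subr_gt0.
rewrite -[ltRHS]ger0_norm ?ltW // -sqrtr_sqr ltr_sqrt ?exprn_gt0 //.
have -> : alpha ^+ 2 * K ^+ 2 = alpha * (m - kap) by rewrite -aK; ring.
rewrite sqrrB expr1n mul1r mulr2n.
have : 0 < alpha * (m - kap) by rewrite mulr_gt0 // subr_gt0.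
have := sqr_ge0 (alpha * kap); lra.
Qed.

End Rate.

(* The premise of the last assertion is vacuous unless S is a singleton. For a
   singleton S the hypotheses do not relate mu and K, and the premise says that
   rho is a well-defined real function of alpha on the admissible range. *)
Theorem theorem17 (R : realType) (n : nat) (S : set 'cV[R]_n)
    (F : 'cV[R]_n -> 'cV[R]_n) (M : 'cV[R]_n -> 'M[R]_n) (L K KM mu : R)
    (S_nonempty : S !=set0) (S_closed : closed S)
    (S_convex : @convex_set R 'cV[R]_n S) (S_compact : compact S)
    (F_continuous : continuous F)
    (M_posdef : forall x, sym_posdef (M x))
    (L_ge1 : 1 <= L) (K_gt0 : 0 < K) (KM_ge0 : 0 <= KM) (mu_gt0 : 0 < mu)
    (M_bounded : forall x, S x -> opnorm (M x) <= L)
    (Minv_bounded : forall x, S x -> opnorm (invmx (M x)) <= L)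
    (F_lipschitz : forall x y, S x -> S y ->
       enorm (F x - F y) <= K * enorm (x - y))
    (M_lipschitz : forall x y, S x -> S y ->
       opnorm (M x - M y) <= KM * enorm (x - y))
    (F_strongly_monotone : forall x y, S x -> S y ->
       mu * enorm (x - y) ^+ 2 <= dotp (F x - F y) (x - y)) :
  (forall (lambda alpha : R) (xbar : 'cV[R]_n),
     0 < lambda ->
     0 < alpha -> alpha < 2 * mu / (L * K ^+ 2) ->
     SOL F S xbar ->
     0 < c_g L K KM mu (Fmax F S) alpha ->
     forall x : R -> 'cV[R]_n,
       trajectory S lambda (Tmap S F M alpha) x ->
       forall t : R, 0 <= t ->
         rdist M xbar (x t) <=
           expR (- (lambda * c_g L K KM mu (Fmax F S) alpha * t)) *
             rdist M xbar (x 0) /\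
         enorm (x t - xbar) <=
           L * expR (- (lambda * c_g L K KM mu (Fmax F S) alpha * t)) *
             enorm (x 0 - xbar))
  /\
  ((forall z, S = [set z] ->
      forall a : R, 0 < a -> a < 2 * mu / (L * K ^+ 2) ->
        0 <= rho_radicand L K mu a) ->
   ((exists alpha : R, 0 < alpha /\ 0 < c_g L K KM mu (Fmax F S) alpha)
    <-> 2^-1 * L ^+ 2 * KM * Fmax F S < mu / L)).

Proof.
have L_gt0 : 0 < L by exact: lt_le_trans L_ge1.
have [z0 Sz0] := S_nonempty.
have fmax_ge0 : 0 <= Fmax F S.
  exact: le_trans (enorm_ge0 _) (le_Fmax S_compact F_continuous Sz0).
split; last first.
  move=> rho_defined; apply: c_g_gt0_exists => //.
  (* Two distinct points give [mu / L <= mu <= K] from the bounds on [F]; for a singleton the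
     inequality comes from the premise on the radicand. *)
  have [[y Sy yz]|S_single] := pselect (exists2 y, S y & y != z0).
    have e0 : 0 < enorm (y - z0).
      rewrite lt0r enorm_ge0 andbT; apply/eqP => /enorm_eq0 /eqP.
      by rewrite subr_eq0 (negbTE yz).
    apply: (@le_trans _ _ mu); first by rewrite ler_pdivrMr // ler_peMr // ltW.
    rewrite -(@ler_pM2r _ (enorm (y - z0) ^+ 2)) ?exprn_gt0 //.
    apply: le_trans (F_strongly_monotone _ _ Sy Sz0) _.
    apply: le_trans (ler_norm _) _; apply: le_trans (dotp_le_enorm _ _) _.
    by rewrite expr2 mulrA ler_wpM2r ?enorm_ge0 // F_lipschitz.
  have SE : S = [set z0].
    apply/seteqP; split=> [y Sy|_ ->] //=; apply: contrapT => /eqP yz.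
    by apply: S_single; exists y.
  (* the radicand is minimal, with value 1 - (mu / (L * K)) ^+ 2, at this [a] *)
  have a0 : 0 < mu / (L * K ^+ 2) by rewrite divr_gt0 // mulr_gt0 // exprn_gt0.
  have := rho_defined _ SE _ a0.
  rewrite -mulrA ltr_pMl // ltr1n => /(_ isT).
  have -> : rho_radicand L K mu (mu / (L * K ^+ 2)) = 1 - (mu / L / K) ^+ 2.
    by rewrite /rho_radicand; field; rewrite !gt_eqF.
  rewrite subr_ge0 -[leRHS](expr1n _ 2) => h.
  have {}h : mu / L / K <= 1.
    have mLK0 : 0 < mu / L / K by rewrite !divr_gt0.
    by move: h; rewrite ler_pXn2r // nnegrE // ltW.
  by move: h; rewrite ler_pdivrMr // mul1r.
move=> lambda alpha xbar lambda0 alpha0 alpha_lt solx.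
set c := c_g _ _ _ _ _ _ => c0 x [x_in acx dx] t t0.
(* The squared distance decays at twice the rate of the distance. *)
pose k := 2 * lambda * c.
have k0 : 0 < k by rewrite !mulr_gt0.
have Sxb : S xbar by case: solx.
have decay : expR (k * t) * rdist M xbar (x t) ^+ 2 <=
    expR (k * 0) * rdist M xbar (x 0) ^+ 2.
  apply: (@ae_upper_derivative_le0 R
    (fun s => expR (k * s) * rdist M xbar (x s) ^+ 2) t t0).
    by apply: (weighted_sqr_rdist_abs_continuous xbar M_posdef L_gt0 KM_ge0
      Minv_bounded M_lipschitz x_in S_compact (ltW k0) t0); exact: acx.
  have [N [mN N0 badN]] := dx; exists N; split=> //.
  apply: subset_trans badN => s /=; apply: contra_not => dxs s0.
  have {}dxs := dxs s0.
  apply: (weighted_sqr_rdist_upper_derivative M_posdef L_gt0 KM_ge0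
    Minv_bounded M_lipschitz x_in (ltW s0) dxs).
  have Sz := x_in _ (ltW s0); set z := x s in Sz *; set A := invmx (M z).
  have sA : sym_semidef A by exact: sym_semidef_inv.
  pose q := rdist M xbar z ^+ 2.
  have qE : q = dotp (z - xbar) (A *m (z - xbar)) by rewrite /q /rdist sqr_qnorm.
  have q0 : 0 <= q by exact: sqr_ge0.
  have Ad : enorm (A *m (z - xbar)) ^+ 2 <= L * q.
    by rewrite qE; exact: enorm_mulmx_form (Minv_bounded _ Sz).
  have step : enorm (Tmap S F M alpha z - z) <= alpha * L * Fmax F S.
    apply: le_trans (Tmap_step F S_convex S_compact alpha0 M_posdef M_bounded Sz) _.
    by rewrite ler_wpM2l ?le_Fmax // mulr_ge0 // ltW.
  have contr := Tmap_contraction S_convex S_compact alpha0 M_posdef M_bounded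
    K_gt0 L_gt0 alpha_lt Minv_bounded F_lipschitz F_strongly_monotone solx Sz.
  rewrite -/A -/q in contr *.
  rewrite enormZ (gtr0_norm lambda0).
  (* One factor [L] comes from the step length, the other from [Ad]; this is twice [lambda] times
     the last term of [c_g], times [q]. *)
  have metric_part : enorm (A *m (z - xbar)) *
      (KM * (lambda * enorm (Tmap S F M alpha z - z)) * enorm (A *m (z - xbar)))
      <= KM * (lambda * (alpha * L * Fmax F S)) * (L * q).
    rewrite mulrCA -expr2; apply: ler_pM => //; rewrite ?sqr_ge0 //.
      by rewrite !mulr_ge0 ?enorm_ge0 // ltW.
    by rewrite ler_wpM2l // ler_pM2l.
  (* The motion of the point, split around [xbar] so that [contr] applies; it contributes at most
     [2 * lambda * (rho - 1) * q]. *)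
  have -> : dotp (lambda *: (Tmap S F M alpha z - z))
      (A *m (z - xbar + (z - xbar))) =
      2 * lambda * (dotp (z - xbar) (A *m (Tmap S F M alpha z - xbar)) - q).
    have -> : Tmap S F M alpha z - z =
        (Tmap S F M alpha z - xbar) - (z - xbar).
      by rewrite opprB addrA subrK.
    rewrite qE (form_sym (z - xbar) (Tmap S F M alpha z - xbar) sA).
    move: (z - xbar) (Tmap S F M alpha z - xbar) => d e.
    by rewrite mulmxDr !dotp_lin; ring.
  have : 2 * lambda * (dotp (z - xbar) (A *m (Tmap S F M alpha z - xbar)) - q)
     <= 2 * lambda * (rho L K mu alpha * q - q).
    by rewrite ler_pM2l ?mulr_gt0 // lerD2r.
  by rewrite /k /c /c_g; lra.
set E := expR _; have E0 : 0 < E by exact: expR_gt0.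
have EE : expR (k * t) * E ^+ 2 = 1.
  rewrite expr2 /E -!expRD -[RHS]expR0; congr expR; rewrite /k; ring.
have r0 y : 0 <= rdist M xbar y by exact: sqrtr_ge0.
have rE : rdist M xbar (x t) <= E * rdist M xbar (x 0).
  rewrite -(@ler_pXn2r _ 2) ?nnegrE ?mulr_ge0 ?r0 ?(ltW E0) // exprMn.
  rewrite -(ler_pM2l (expR_gt0 (k * t))) [leRHS]mulrA EE mul1r.
  by move: decay; rewrite mulr0 expR0 mul1r.
split=> //.
have St := x_in _ t0; have S0 := x_in _ (lexx 0).
rewrite -(@ler_pXn2r _ 2) ?nnegrE ?mulr_ge0 ?enorm_ge0 ?(ltW E0) ?(ltW L_gt0) //.
(* Passing to the Euclidean norm costs a factor [L] in the square at time [t] and another at time 0,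
   hence [L] after the root. *)
have h1 : enorm (x t - xbar) ^+ 2 <= L * rdist M xbar (x t) ^+ 2.
  rewrite /rdist sqr_qnorm; last exact: sym_semidef_inv.
  exact: enorm_le_inv_form (M_bounded _ St).
have h2 := sqr_rdist_le xbar M_posdef Minv_bounded S0.
apply: (le_trans h1); rewrite -!mulrA !exprMn [L ^+ 2]expr2 -mulrA ler_pM2l //.
apply: (@le_trans _ _ (E ^+ 2 * rdist M xbar (x 0) ^+ 2)).
  by rewrite -exprMn lerXn2r ?nnegrE ?mulr_ge0 ?r0 ?(ltW E0).
by rewrite mulrCA ler_pM2l // exprn_gt0.
Qed.
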